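(* Let $k > 2$ be a natural number, let $h \geq 1$ be a natural number, and let $p$ be a natural number of the form $p = (k-1)!\,h + 1$ or $p = (k-1)!\,h - 1$. Then $p$ is prime if and only if $$(p-k)! \equiv (-1)^{k + \left[\frac{p}{h}\right]+1} \cdot h \pmod{p}.$$
   Context: For a real number $x$, $[x]$ denotes the integer part of $x$, i.e. the largest integer less than or equal to $x$.
   Formalization: The case h = 1, p = (k-1)!+1 is excluded, since there the sign is wrong for prime p (k = 3, h = 1, p = 3: 0! = 1 but the right side is -1 mod 3); p ≥ k is also assumed so that (p-k)! is defined, which excludes only k = 3, h = 1, p = 1. *)

(* Defs.v *)
From mathcomp Require Import all_boot all_order all_algebra.

Set Implicit Arguments.
Unset Strict Implicit.
Unset Printing Implicit Defensive.

(* Main.v *)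
Require Import Defs.
From mathcomp Require Import all_boot all_order all_algebra.
From mathcomp Require Import ring zify.

Import Order.TTheory GRing.Theory Num.Theory.
Local Open Scope ring_scope.

(* Since [p - j = -j] modulo [p], for every [p >= k], prime or not,
    [(p-1)! = (-1)^(k-1) (k-1)! (p-k)!] modulo [p].  As [(k-1)! h = c] modulo
    [p] with [c = 1] or [c = -1], the factorial [(k-1)!] is invertible modulo
    [p], so that [(p-k)! = c (-1)^k h] modulo [p] is equivalent to Wilson's
    criterion [(p-1)! = -1].  Finally [(k-1)!] is even, and the parity of
    [floor (p / h)] encodes the sign [c]. *)

(** Induction on [k]: the top factor p - (k+1) of (p-k-1)! is -(k+1) modulo p. *)
Lemma dvdz_fact_pred_sub (p k : nat) : (k < p)%N ->
  (p %| (p.-1)`!%:Z - (-1) ^+ k * k`!%:Z * (p - k.+1)`!%:Z)%Z.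
Proof.
elim: k => [|k IHk] lt_kp.
  by rewrite expr0 fact0 !mul1r subn1 subrr dvdz0.
have := IHk (ltnW lt_kp).
have -> : (p - k.+1 = (p - k.+2).+1)%N by lia.
rewrite !factS exprS => dvd_k.
have pE : ((p - k.+2).+1)%:Z = p%:Z - k.+1%:Z :> int by lia.
rewrite !PoszM pE in dvd_k *.
set u := (-1) ^+ k in dvd_k *; set f := Posz k`! in dvd_k *.
set g := Posz (p - k.+2)`! in dvd_k *; set w := Posz (p.-1)`! in dvd_k *.
have -> : w - -1 * u * (k.+1%:Z * f) * g
    = w - u * f * ((p%:Z - k.+1%:Z) * g) + u * f * g * p%:Z by ring.
by rewrite rpredD ?dvdz_mull.
Qed.

Lemma prime_dvdz_fact_sub (k p : nat) (c h : int) :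
    (1 < p)%N -> (k < p)%N -> c * c = 1 -> (p %| k`!%:Z * h - c)%Z ->
  prime p = (p %| (p - k.+1)`!%:Z - c * (-1) ^+ k.+1 * h)%Z.
Proof.
move=> p_gt1 lt_kp cc1 dvd_c; rewrite Wilson //.
have := @dvdz_fact_pred_sub p k lt_kp.
have -> : (p %| (p.-1)`!.+1)%N = (p %| (p.-1)`!%:Z + 1)%Z.
  by rewrite /dvdz /= -addn1.
have uu1 : (-1) ^+ k * (-1) ^+ k = 1 :> int by rewrite -expr2 sqrr_sign.
rewrite exprS; move: uu1 dvd_c.
set u := (-1) ^+ k; set m := Posz k`!; set f := Posz (p - k.+1)`!.
set w := Posz (p.-1)`!.
move=> uu1 /dvdzP[a aE] /dvdzP[b bE].
apply/dvdzP/dvdzP => -[q qE].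
(* Multiply w = u m f by c u h, the inverse of u m modulo p since u u = c c = 1 and m h = c. *)
- exists (c * (u * h * (q - b) - a * f)).
  have -> : c * (u * h * (q - b) - a * f) * p
      = c * (u * h) * (q * p - b * p) - c * f * (a * p) by ring.
  rewrite -qE -bE -aE.
  have -> : c * (u * h) * (w + 1 - (w - u * m * f)) - c * f * (m * h - c)
      = c * u * h + u * u * (c * m * f * h) - c * f * m * h + c * c * f by ring.
  by rewrite uu1 cc1; ring.
(* Conversely, multiply f = - c u h by u m. *)
- exists (b + u * m * q - c * a).
  have -> : (b + u * m * q - c * a) * p
      = b * p + u * m * (q * p) - c * (a * p) by ring.
  rewrite -qE -bE -aE.
  have -> : w - u * m * f + u * m * (f - c * (-1 * u) * h) - c * (m * h - c)
      = w + u * u * (m * c * h) - c * m * h + c * c by ring.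
  by rewrite uu1 cc1; ring.
Qed.

Lemma odd_fact (n : nat) : odd n`! = (n < 2)%N.
Proof.
case: n => [|[|n]] //=; apply: negbTE.
by rewrite -dvdn2 dvdn_fact.
Qed.

Lemma floor_divn (m d : nat) : Num.floor (m%:Q / d%:Q) = (m %/ d)%N%:Z.
Proof.
case: (posnP d) => [->|d_gt0]; first by rewrite divn0 invr0 mulr0 floor0.
have dQ_gt0 : 0 < d%:Q by rewrite ltr0n.
apply: floor_def; rewrite ler_pdivlMr // ltr_pdivrMr //.
rewrite -!rmorphM /= ler_int ltr_int.
by move: (divn_eq m d) (ltn_pmod m d_gt0); nia.
Qed.

(* [p_ge_k] makes [(p - k)!] meaningful; it only excludes k = 3, h = 1, p = 1.
   [not_exc] excludes h = 1, p = (k-1)! + 1, where the equivalence is false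
   whenever p is prime (e.g. k = 3, p = 3: 0! = 1, while (-1)^7 * 1 = -1). *)
Theorem theorem4 (k h p : nat) (k_gt2 : (2 < k)%N) (h_ge1 : (1 <= h)%N)
    (p_form : (p = (k - 1)`! * h + 1)%N \/ (p = (k - 1)`! * h - 1)%N)
    (p_ge_k : (k <= p)%N)
    (not_exc : ~ (h = 1%N /\ p = ((k - 1)`! + 1)%N)) :
  prime p <->
  (((p - k)`!)%N%:Z
     = (-1) ^ (k%:Z + Num.floor (p%:Q / h%:Q) + 1) * h%:Z %[mod p%:Z])%Z.
Proof.
rewrite floor_divn -!PoszD.
(* From here [k] is the k - 1 of the statement. *)
case: k => [//|k] in k_gt2 p_form p_ge_k not_exc *.
rewrite subSS subn0 in p_form not_exc.
have even_m : ~~ odd k`! by rewrite odd_fact -leqNgt.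
have m_gt0 := fact_gt0 k.
have [c [cc1 dvd_c sgnE]] : exists c : int,
  [/\ c * c = 1, (p %| k`!%:Z * h%:Z - c)%Z
    & (-1) ^+ (k.+1 + p %/ h + 1) = c * (-1) ^+ k.+1].
  case: p_form => pE.
    (* With h > 1 the remainder 1 is below h, so [p %/ h] is k!, which is even. *)
    have h_gt1 : (1 < h)%N.
      by case: (ltngtP 1 h) h_ge1 => // h1 _; case: not_exc; split; lia.
    exists (-1); split => //; first by apply/dvdzP; exists 1; rewrite pE; lia.
    rewrite pE divnMDl ?divn_small // addn0 -addnA addn1 exprD (exprS _ k`!).
    by rewrite -(signr_odd _ k`!) (negbTE even_m) mulr1 mulrC.
  exists 1; split => //; first by apply/dvdzP; exists 1; rewrite pE; nia.
  (* Here p = (k! - 1) h + (h - 1), so the quotient is odd. *)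
  have -> : (p %/ h = k`!.-1)%N.
    apply/eqP; rewrite eqn_leq -ltnS prednK // ltn_divLR // leq_divRL //.
    by apply/andP; split; nia.
  rewrite mul1r -addnA addn1 prednK // exprD -(signr_odd _ k`!).
  by rewrite (negbTE even_m) mulr1.
rewrite (@prime_dvdz_fact_sub k p c h) //; last by lia.
by rewrite -sgnE -eqz_mod_dvd; split => /eqP.
Qed.
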